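(* Let $N,k$ be non-negative integers and $l$ a positive integer, and let $Q_{k,l}(m,n)=(m+n)l+k\frac{n(n-1)}{2}+(n-1)mk+(k+1)\frac{m(m+1)}{2}$. Then \begin{align*} \sum_{j\geq 0}x^jq^{lj+kj(j-1)/2}{N-l-(j-1)k+j \brack j}_q =\sum_{m,n\geq 0}x^{m+n}q^{Q_{k,l}(m,n)}{N-(l+(n-1)k+m(k+1))+m \brack m}_q{N-(l+(n-1)k)-km+\lfloor n/2\rfloor \brack \lfloor n/2\rfloor}_{q^2}. \end{align*}
   Context: For integers $A,B$ and base $p$, ${A\brack B}_p=\frac{(p;p)_A}{(p;p)_B(p;p)_{A-B}}$ if $0\le B\le A$ and $0$ otherwise, where $(a;p)_j=\prod_{i=0}^{j-1}(1-ap^i)$. $\lfloor\cdot\rfloor$ is the floor function. Both sides are regarded as formal power series in $x,q$. *)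

(* Defs.v *)
From mathcomp Require Import all_boot all_order all_algebra.
From mathcomp Require Import ring lra zify.

Set Implicit Arguments.
Unset Strict Implicit.
Unset Printing Implicit Defensive.

Import Order.TTheory GRing.Theory Num.Theory.
Local Open Scope ring_scope.

Definition qpoch (R : comNzRingType) (a p : R) (j : nat) : R :=
  \prod_(i < j) (1 - a * p ^+ i).

(* The division is Euclidean division in Q[q]. It is exact (qbinom_exact), and
   its divisor is nonzero when p has zero constant term (qpoch_neq0), so this
   is the quotient of q-Pochhammer symbols. *)
Definition qbinom (p : {poly rat}) (A B : int) : {poly rat} :=
  if (0 <= B) && (B <= A)
  then qpoch p p `|A|%N %/ (qpoch p p `|B|%N * qpoch p p `|A - B|%N)
  else 0.

(* Both divisions by 2 are exact. *)
Definition Qkl (k l m n : int) : int :=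
  (m + n) * l + k * (n * (n - 1) %/ 2)%Z + (n - 1) * m * k
  + (k + 1) * (m * (m + 1) %/ 2)%Z.

(* Polynomials in x whose coefficients are polynomials in q. *)
Definition xq_poly := {poly {poly rat}}.

(* S a b is the coefficient of x^a q^b. *)
Definition xq_series := nat -> nat -> rat.

(* S is the sum of the family t in the ring of formal power series in x and q:
   each coefficient is nonzero in finitely many terms only, and S collects
   these finite sums. *)
Definition fps_has_sum (I : eqType) (t : I -> xq_poly) (S : xq_series) : Prop :=
  forall a b : nat, exists s : seq I,
    [/\ uniq s,
        forall i, i \notin s -> (t i)`_a`_b = 0
      & S a b = \sum_(i <- s) (t i)`_a`_b].

Definition lhs_term (N k l j : nat) : xq_poly :=
  'X^j * ('X ^ (l%:Z * j%:Z + (k%:Z * j%:Z * (j%:Z - 1) %/ 2)%Z)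
          * qbinom 'X (N%:Z - l%:Z - (j%:Z - 1) * k%:Z + j%:Z) j%:Z)%:P.

(* Exponents of q are integers; they are nonnegative by lhs_exp_ge0 and Qkl_ge0,
   so that ^ is an ordinary power of the polynomial variable. *)
Definition rhs_term (N k l : nat) (mn : nat * nat) : xq_poly :=
  let: (m, n) := mn in
  'X^(m + n) *
  ('X ^ Qkl k l m n
   * qbinom 'X (N%:Z - (l%:Z + (n%:Z - 1) * k%:Z + m%:Z * (k%:Z + 1)) + m%:Z) m%:Z
   * qbinom 'X^2 (N%:Z - (l%:Z + (n%:Z - 1) * k%:Z) - k%:Z * m%:Z + (n %/ 2)%N%:Z)
                 (n %/ 2)%N%:Z)%:P.

Lemma fps_has_sum_unique (I : eqType) (t : I -> xq_poly) (S S' : xq_series) :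
  fps_has_sum t S -> fps_has_sum t S' -> forall a b, S a b = S' a b.
Proof.
move=> h h' a b; have [s [us zs ->]] := h a b; have [s' [us' zs' ->]] := h' a b.
rewrite (bigID (mem s')) /= [X in _ + X]big1 ?addr0; last by move=> i /zs'.
rewrite [RHS](bigID (mem s)) /= [X in _ = _ + X]big1 ?addr0; last by move=> i /zs.
rewrite -big_filter -[RHS]big_filter; apply: perm_big.
by apply: uniq_perm; rewrite ?filter_uniq // => i; rewrite !mem_filter andbC.
Qed.

Lemma lhs_exp_ge0 (k l j : nat) :
  0 <= l%:Z * j%:Z + (k%:Z * j%:Z * (j%:Z - 1) %/ 2)%Z.
Proof.
rewrite addr_ge0 ?mulr_ge0 // divz_ge0 //; case: j => [|j]; first by rewrite mulr0 mul0r.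
by rewrite !mulr_ge0 // subr_ge0.
Qed.

Lemma Qkl_ge0 (k l m n : nat) : 0 <= Qkl k l m n.
Proof.
rewrite /Qkl.
have h1 : 0 <= (n%:Z * (n%:Z - 1) %/ 2)%Z.
  by rewrite divz_ge0 //; nia.
have h2 : m%:Z <= (m%:Z * (m%:Z + 1) %/ 2)%Z.
  by rewrite lez_divRL //; nia.
nia.
Qed.

Lemma qpochS (p : {poly rat}) j : qpoch p p j.+1 = qpoch p p j * (1 - p ^+ j.+1).
Proof. by rewrite /qpoch big_ord_recr /= exprS. Qed.

Lemma qpoch_dvd (p : {poly rat}) b c :
  qpoch p p b * qpoch p p c %| qpoch p p (b + c).
Proof.
have p0 : qpoch p p 0 = 1 by rewrite /qpoch big_ord0.
move: {2}(b + c)%N (leqnn (b + c)) => n.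
elim: n b c => [|n IHn] [|b] [|c] le; rewrite ?p0 ?mulr1 ?mul1r ?addn0 ?dvdpp //.
have -> : qpoch p p (b.+1 + c.+1) =
    qpoch p p (b + c.+1) * (1 - p ^+ b.+1)
    + p ^+ b.+1 * (qpoch p p (b.+1 + c) * (1 - p ^+ c.+1)).
  have -> : (b.+1 + c = b + c.+1)%N by rewrite addSnnS.
  by rewrite [in LHS]addSn qpochS -addSn exprD; ring.
apply: dvdp_add.
  by rewrite qpochS mulrAC dvdp_mul ?dvdpp // IHn //; lia.
by apply: dvdp_mull; rewrite (qpochS p c) mulrA dvdp_mul ?dvdpp // IHn //; lia.
Qed.

Lemma qbinom_exact (p : {poly rat}) (A B : int) : 0 <= B -> B <= A ->
  qbinom p A B * (qpoch p p `|B|%N * qpoch p p `|A - B|%N) = qpoch p p `|A|%N.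
Proof.
move=> B0 BA; rewrite /qbinom B0 BA /= divpK //.
have -> : `|A|%N = (`|B| + `|A - B|)%N by lia.
exact: qpoch_dvd.
Qed.

Lemma qpoch_neq0 (p : {poly rat}) j : p.[0] = 0 -> qpoch p p j != 0.
Proof.
move=> p0; apply/eqP => /(congr1 (horner^~ 0)); rewrite horner0 /qpoch horner_prod.
rewrite big1 => [/eqP|i _]; first by rewrite oner_eq0.
by rewrite !hornerE p0 mul0r subr0.
Qed.

(* Main.v *)
Require Import Defs.
From mathcomp Require Import all_boot all_order all_algebra.
From mathcomp Require Import ring zify.

(** Put [M = N - l - (j - 1) k].  Once the common power
    [q^(l j + k j (j - 1) / 2)] is removed, the coefficient of [x^j] in the
    claim reads
      [[M + j, j]_q = \sum_(m + n = j) q^(m (m + 1) / 2) [M, m]_q [M + n/2, n/2]_(q^2)].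
    Both sides vanish if [M < 0]. For [M >= 0] this is the coefficient form of
      [1 / (x; q)_(M+1) = (- x q; q)_M * (1 + x) / (x^2; q^2)_(M+1)],
    proved by induction on [M]: passing from [M] to [M + 1], with [y = q^(M+1)],
    divides the left side by [1 - x y], and multiplies the right side by
    [(1 + x y) / (1 - x^2 y^2)]. *)

Set Implicit Arguments.
Unset Strict Implicit.
Unset Printing Implicit Defensive.

Import Order.TTheory GRing.Theory Num.Theory.
Local Open Scope ring_scope.

Section Convolution.

Variable R : comNzRingType.
Implicit Types f g : nat -> R.

Definition conv f g (j : nat) : R := \sum_(i < j.+1) f i * g (j - i)%N.

(** Multiplication by [x], when a sequence stands for the coefficients of a power series and [conv]
    for the product. *)
Definition shift f (i : nat) : R := if i is i'.+1 then f i' else 0.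

Lemma eq_conv f f' g g' : f =1 f' -> g =1 g' -> conv f g =1 conv f' g'.
Proof. by move=> ef eg j; apply: eq_bigr => i _; rewrite ef eg. Qed.

Lemma conv_shiftl f g : conv (shift f) g =1 shift (conv f g).
Proof.
case=> [|j]; first by rewrite /conv big_ord_recl big_ord0 mul0r addr0.
by rewrite /conv big_ord_recl mul0r add0r; apply: eq_bigr.
Qed.

Lemma conv_shiftr f g : conv f (shift g) =1 shift (conv f g).
Proof.
case=> [|j]; first by rewrite /conv big_ord_recl big_ord0 mulr0 addr0.
rewrite /conv big_ord_recr /= subnn mulr0 addr0.
by apply: eq_bigr => i _; rewrite subSn // -ltnS.
Qed.

Lemma conv_addZl y f f' g j :
  conv (fun i => f i + y * f' i) g j = conv f g j + y * conv f' g j.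
Proof.
rewrite /conv mulr_sumr -big_split; apply: eq_bigr => i _ /=.
by rewrite mulrDl mulrA.
Qed.

Lemma conv_addZr y f g g' j :
  conv f (fun i => g i + y * g' i) j = conv f g j + y * conv f g' j.
Proof.
rewrite /conv mulr_sumr -big_split; apply: eq_bigr => i _ /=.
by rewrite mulrDr mulrCA.
Qed.

(* In generating functions: if [e' = (1 + x y) e] and [h = (1 - x^2 y^2) h'],
   then [(1 - x y) e' h' = e h]. *)
Lemma conv_step y e e' h h' :
    (forall i, e' i = e i + y * shift e i) ->
    (forall i, h i = h' i + - y ^+ 2 * shift (shift h') i) ->
  forall j, conv e' h' j = conv e h j + y * shift (conv e' h') j.
Proof.
move=> e'E hE.
(* Both products are expressed through [conv e h'], so that the claim becomes
   [(1 - x y) (1 + x y) = 1 - x^2 y^2]. *)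
have convE' i : conv e' h' i = conv e h' i + y * shift (conv e h') i.
  by rewrite (eq_conv e'E (frefl h')) conv_addZl conv_shiftl.
have convE i : conv e h i = conv e h' i + - y ^+ 2 * shift (shift (conv e h')) i.
  rewrite (eq_conv (frefl e) hE) conv_addZr conv_shiftr.
  by congr (_ + _ * _); case: i => //= i; rewrite conv_shiftr.
by case=> [|j]; rewrite convE' convE /= ?convE' /=; ring.
Qed.

End Convolution.

Section GaussianBinomials.

Variable p : {poly rat}.
Hypothesis p0 : p.[0] = 0.

(** The denominator is nonzero because [p] has no constant term, so it cancels. Values of the
    Euclidean quotient thus follow from identities without division. *)
Lemma qbinom_unique (a b : nat) c :
  c * (qpoch p p b * qpoch p p a) = qpoch p p (a + b) ->
  qbinom p (a + b)%N b = c.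
Proof.
move=> cE; apply: (@mulIf _ (qpoch p p b * qpoch p p a)).
  by rewrite mulf_neq0 ?qpoch_neq0.
rewrite cE; have := @qbinom_exact p (a + b)%N b.
have -> : `|(a + b)%N%:Z - b%:Z|%N = a by lia.
by apply=> //; lia.
Qed.

Lemma qbinom_poch (a b : nat) :
  qbinom p (a + b)%N b * (qpoch p p b * qpoch p p a) = qpoch p p (a + b).
Proof.
have := @qbinom_exact p (a + b)%N b.
have -> : `|(a + b)%N%:Z - b%:Z|%N = a by lia.
by apply=> //; lia.
Qed.

Lemma qbinomn0 (a : nat) : qbinom p a 0 = 1.
Proof.
rewrite -{1}[a]addn0; apply: qbinom_unique.
by rewrite addn0 mul1r {1}/qpoch big_ord0 mul1r.
Qed.

Lemma qbinomnn (a : nat) : qbinom p a a = 1.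
Proof.
rewrite -{1}[a]add0n; apply: qbinom_unique.
by rewrite add0n mul1r [X in _ * X]/qpoch big_ord0 mulr1.
Qed.

Lemma qbinom_small (a b : int) : a < b -> qbinom p a b = 0.
Proof. by move=> lt_ab; rewrite /qbinom [b <= a]leNgt lt_ab andbF. Qed.

(** After clearing denominators this is [1 - p^(a+b+2) = (1 - p^(a+1)) + p^(a+1) (1 - p^(b+1))]. *)
Lemma qbinom_pascal (a b : nat) :
  qbinom p (a.+1 + b.+1)%N b.+1 =
    qbinom p (a + b.+1)%N b.+1 + p ^+ a.+1 * qbinom p (a.+1 + b)%N b.
Proof.
apply: qbinom_unique; rewrite mulrDl.
have h1 := qbinom_poch a b.+1; have h2 := qbinom_poch a.+1 b.
have -> : qpoch p p (a.+1 + b.+1) = qpoch p p (a + b.+1) * (1 - p ^+ (a.+1 + b.+1)).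
  by rewrite addSn qpochS.
rewrite (qpochS p a) in h2 *; rewrite (qpochS p b) in h1 *.
have e : (a.+1 + b = a + b.+1)%N by rewrite addSnnS.
transitivity (qpoch p p (a + b.+1) * (1 - p ^+ a.+1)
              + p ^+ a.+1 * (qpoch p p (a.+1 + b) * (1 - p ^+ b.+1))).
  by rewrite -h1 -h2; ring.
by rewrite e exprD; ring.
Qed.

(** By the [q]-binomial theorem [p^(m(m+1)/2) [M, m]_p] is the coefficient of [x^m] in
    [(- x p; p)_M]; the recurrence expresses multiplication by [1 + x p^(M+1)]. *)
Lemma qbinom_rowS (M m : nat) :
  p ^+ 'C(m.+2, 2) * qbinom p M.+1 m.+1 =
    p ^+ 'C(m.+2, 2) * qbinom p M m.+1
    + p ^+ M.+1 * (p ^+ 'C(m.+1, 2) * qbinom p M m).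
Proof.
have e2 : ('C(m.+2, 2) = 'C(m.+1, 2) + m.+1)%N by rewrite binS bin1.
case: (ltngtP m M) => [ltmM|ltMm|<-].
- have [c cE] : exists c, M = (c + m.+1)%N by exists (M - m.+1)%N; lia.
  rewrite cE -addSn qbinom_pascal mulrDr addSnnS; congr (_ + _).
  by rewrite e2 !mulrA -!exprD; congr (p ^+ _ * _); lia.
- by rewrite !qbinom_small ?mulr0 ?addr0 //; lia.
- rewrite !qbinomnn qbinom_small ?mulr0 ?add0r ?mulr1; last by lia.
  by rewrite e2 exprD mulrC.
Qed.

End GaussianBinomials.

Lemma qbinom_conv (M : nat) :
  (fun j => qbinom 'X (M + j)%N j) =1
  conv (fun m => 'X ^+ 'C(m.+1, 2) * qbinom 'X M m)
       (fun n => qbinom 'X^2 (M + n %/ 2)%N (n %/ 2)%N).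
Proof.
have X0 : ('X : {poly rat}).[0] = 0 by rewrite hornerX.
have XX0 : ('X^2 : {poly rat}).[0] = 0 by rewrite hornerXn.
elim: M => [|M IHM] j.
  rewrite qbinomnn // /conv big_ord_recl big1 => [|i _].
    by rewrite qbinomn0 // qbinomnn // !mulr1 addr0.
  by rewrite (@qbinom_small 'X 0) ?mulr0 ?mul0r.
set h := (fun n : nat => qbinom 'X^2 (M + n %/ 2)%N (n %/ 2)%N) in IHM.
set e := (fun m : nat => _ * qbinom 'X M m) in IHM.
set h' := (fun n : nat => qbinom 'X^2 _ _); set e' := (fun m : nat => _ * _).
have e'E i : e' i = e i + 'X ^+ M.+1 * shift e i.
  by case: i => [|m]; rewrite /e' /e /= ?qbinom_rowS // !qbinomn0 // mulr0 addr0.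
(* The factor [1 + x] repeats each coefficient, whence the index [n %/ 2]. Lowering [n] by two
   lowers it by one, and Pascal's rule in base [q^2] applies. *)
have hE i : h i = h' i + - ('X ^+ M.+1) ^+ 2 * shift (shift h') i.
  rewrite /h /h'; case: i => [|[|n]] /=.
  - by rewrite !divn_small // !qbinomn0 // mulr0 addr0.
  - by rewrite !divn_small // !qbinomn0 // mulr0 addr0.
  have -> : (n.+2 %/ 2 = (n %/ 2).+1)%N by lia.
  by rewrite qbinom_pascal // -exprM mulnC exprM; ring.
(* Both sides now obey the same first-order recurrence in [j]. *)
elim: j => [|j IHj]; rewrite (conv_step e'E hE) -IHM /=.
  by rewrite !qbinomn0 // mulr0 addr0.
by rewrite qbinom_pascal // IHj.
Qed.

Lemma bin2Z (n : nat) : n%:Z * (n%:Z - 1) = 'C(n, 2)%:Z * 2.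
Proof. by elim: n => // n IHn; rewrite binS bin1; lia. Qed.

Lemma lhs_expE (k l j : nat) :
  l%:Z * j%:Z + (k%:Z * j%:Z * (j%:Z - 1) %/ 2)%Z = (l * j + k * 'C(j, 2))%N.
Proof. by rewrite -mulrA bin2Z mulrA mulzK. Qed.

(** The multiples of [k] combine through [(n - 1) m + 'C(m+1, 2) + 'C(n, 2) = 'C(m+n, 2)]. For fixed
    [m + n], only ['C(m+1, 2)] varies. *)
Lemma QklE (k l m n : nat) :
  Qkl k l m n = (l * (m + n) + k * 'C(m + n, 2) + 'C(m.+1, 2))%N.
Proof.
have := bin2Z (m + n); have := bin2Z m.+1; have := bin2Z n.
rewrite /Qkl => hn.
have -> : m%:Z * (m%:Z + 1) = m.+1%:Z * (m.+1%:Z - 1) by lia.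
move=> hm; rewrite hn hm !mulzK // => hmn.
nia.
Qed.

Theorem theorem2p7 (N k l : nat) (hl : (0 < l)%N) :
  exists S : xq_series,
    fps_has_sum (lhs_term N k l) S /\ fps_has_sum (rhs_term N k l) S.
Proof.
pose L j : {poly rat} := 'X ^ (l%:Z * j%:Z + (k%:Z * j%:Z * (j%:Z - 1) %/ 2)%Z)
          * qbinom 'X (N%:Z - l%:Z - (j%:Z - 1) * k%:Z + j%:Z) j%:Z.
exists (fun a b => (L a)`_b); split=> a b.
  exists [:: a]; split=> // [i|].
    by rewrite inE coefXnM coefC subn_eq0 => /negPf; case: ltngtP; rewrite ?coef0.
  by rewrite big_seq1 coefXnM ltnn subnn coefC.
(* Only the pairs with [m + n = a] contribute to [x^a]. *)
exists [seq (m, a - m)%N | m <- iota 0 a.+1]; split.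
- by rewrite map_inj_uniq ?iota_uniq // => x y [].
- case=> m n /mapP nmn; rewrite coefXnM coefC.
  have nE : (m + n)%N != a.
    by apply/eqP => E; apply: nmn; exists m; rewrite ?mem_iota; [lia|congr (_, _); lia].
  by rewrite subn_eq0; case: ltngtP nE; rewrite ?coef0.
rewrite big_map -[iota _ _]/(index_iota 0 a.+1) big_mkord.
pose M : int := N%:Z - l%:Z - (a%:Z - 1) * k%:Z.
pose T i : {poly rat} := 'X ^+ 'C(i.+1, 2) * qbinom 'X M i
  * qbinom 'X^2 (M + ((a - i) %/ 2)%N) ((a - i) %/ 2)%N.
(* With [m + n = a] fixed, the upper indices simplify to [M] and [M + n %/ 2]. *)
have TE (i : 'I_a.+1) :
    (rhs_term N k l (val i, (a - i)%N))`_a = 'X ^+ (l * a + k * 'C(a, 2)) * T i.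
  have le_ia : (i <= a)%N by rewrite -ltnS.
  rewrite /rhs_term subnKC // coefXnM ltnn subnn coefC QklE subnKC //= -exprnP.
  rewrite exprD /T -!mulrA; congr (_ * (_ * (qbinom _ _ _ * qbinom _ _ _))).
    by rewrite /M -subzn //; ring.
  by congr (_ + _); rewrite /M -subzn //; ring.
rewrite (eq_bigr _ (fun i _ => congr1 (fun r : {poly rat} => r`_b) (TE i))).
rewrite -coef_sum -mulr_sumr /L lhs_expE -exprnP -/M; congr ((_ * _ : {poly rat})`_b).
(* For negative [M], the upper index is below the lower one in [[M + a, a]] and in every [[M, i]],
   even for [i = 0]. *)
case: (ltP M 0) => [M_lt0 | M_ge0].
  rewrite qbinom_small ?big1 // => [i _|]; last by lia.
  by rewrite /T qbinom_small ?mulr0 ?mul0r //; lia.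
have [n nE] : exists n : nat, M = n by exists `|M|%N; lia.
by rewrite /T nE; apply: (qbinom_conv n a).
Qed.
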